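(* Let $r, d \ge 2$ be integers. There exist $d+1$ sets $X_1, \ldots, X_{d+1}$, each consisting of $r$ hyperplanes in $\mathbb{R}^d$, such that their union (a family of $r(d+1)$ hyperplanes) is in general position and the following holds. For any partition of the union $X_1 \cup \cdots \cup X_{d+1}$ into $r$ sets $A_1, \ldots, A_r$ such that each $A_j$ contains exactly one hyperplane of each $X_i$, there are two sets $A_j, A_{j'}$ with $j\neq j'$ whose induced simplices do not intersect, i.e. $\triangle(A_j) \cap \triangle(A_{j'}) = \emptyset$.
   Context: Hyperplanes are affine hyperplanes. A family of hyperplanes in $\mathbb{R}^d$ is in general position if the normal vectors of any $d$ hyperplanes of the family are linearly independent and no $d+1$ hyperplanes of the family have a common point. For a set $A$ of $d+1$ hyperplanes in general position, the induced simplex $\triangle(A)$ is the (closed) $d$-dimensional simplex bounded by them, i.e. the convex hull of the $d+1$ points obtained by intersecting each of the $d+1$ subfamilies of $d$ hyperplanes of $A$. *)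

(* Defs.v *)
From mathcomp Require Import all_boot all_order all_algebra.
From mathcomp Require Import boolp classical_sets cardinality reals convex.

Set Implicit Arguments.
Unset Strict Implicit.
Unset Printing Implicit Defensive.

Import Order.TTheory GRing.Theory Num.Theory.

Local Open Scope classical_set_scope.
Local Open Scope ring_scope.

(* Points and normal vectors of R^d are row vectors; an affine hyperplane is the
   set of its points. *)

Definition dot (R : realType) (d : nat) (a x : 'rV[R]_d) : R :=
  \sum_(i < d) a 0 i * x 0 i.

Definition normal_vector (R : realType) (d : nat)
    (H : set 'rV[R]_d) (a : 'rV[R]_d) : Prop :=
  a != 0 /\ exists b : R, H = [set x | dot a x = b].

Definition hyperplane (R : realType) (d : nat) (H : set 'rV[R]_d) : Prop :=
  exists a : 'rV[R]_d, normal_vector H a.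

(* Injectivity of H expresses that the d (resp. d + 1) members of the family are
   distinct. *)
Definition general_position (R : realType) (d : nat)
    (F : set (set 'rV[R]_d)) : Prop :=
  (forall (H : 'I_d -> set 'rV[R]_d) (a : 'I_d -> 'rV[R]_d),
      injective H -> (forall i, F (H i)) ->
      (forall i, normal_vector (H i) (a i)) ->
      row_free (\matrix_(i < d) a i)) /\
  (forall H : 'I_d.+1 -> set 'rV[R]_d,
      injective H -> (forall i, F (H i)) ->
      \bigcap_(i in [set: 'I_d.+1]) H i = set0).

Definition convex_hull (R : realType) (d : nat)
    (S : set 'rV[R]_d) : set 'rV[R]_d :=
  smallest (@convex_set R 'rV[R]_d) S.

(* When A consists of d + 1 hyperplanes in general position, each of the inner
   intersections is a single point, the vertex opposite to the facet on H. *)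
Definition induced_simplex (R : realType) (d : nat)
    (A : set (set 'rV[R]_d)) : set 'rV[R]_d :=
  convex_hull (\bigcup_(H in A) \bigcap_(G in A `\ H) G).

(* Main.v *)
(* In the plane with coordinates (x, t) take three pairs of lines, a common and
   an exceptional one in each: x = t and x = -t, x = -1 and x = 2, t = 3 and
   t = -3. Choosing one line of each pair gives eight triangles; any two that use
   complementary choices are disjoint, and so are the two triangles with exactly
   one exceptional line, taken from the first or from the second pair. Let X_1,
   X_2, X_3 consist of r - 1 copies of the common line and one exceptional line.
   In a partition into rainbow sets the three exceptional lines occur in one, two
   or three parts: in the first two cases some two parts make complementary
   choices, in the third we are in the remaining case. In R^d the line x + at = 0
   becomes x + at + y_3 + ... + y_d = 0, the other two families are unchanged,
   and the k-th further family consists of copies of y_k = 0. The disjointness is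
   strict, so it survives a small perturbation to general position; one moves
   along the segment to a configuration on the moment curve, where general
   position is a Vandermonde determinant, hence holds for all but finitely many
   parameters. *)
Require Import Defs.
From mathcomp Require Import all_boot all_order all_algebra.
From mathcomp Require Import boolp classical_sets cardinality reals convex.
From mathcomp Require Import interval_inference.
From mathcomp Require Import ring lra.

Import Order.TTheory GRing.Theory Num.Theory.

Local Open Scope classical_set_scope.
Local Open Scope card_scope.
Local Open Scope ring_scope.

(** * Polynomials near zero *)

Lemma horner_continuous0 {R : realFieldType} (q : {poly R}) (e : R) :
  0 < e -> exists2 d : R, 0 < d & forall x, 0 < x < d -> `|q.[x] - q.[0]| < e.
Proof.
elim/poly_ind: q e => [|p c IH] e e0.
  by exists 1 => // x _; rewrite !horner0 subrr normr0.
have [d d0 dP] := IH 1 ltr01.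
have B0 : 0 < `|p.[0]| + 1 by rewrite ltr_wpDl.
exists (Num.min d (e / (`|p.[0]| + 1))).
  by rewrite lt_min d0 divr_gt0.
move=> x /andP[x0]; rewrite lt_min => /andP[xd xe].
rewrite !hornerMXaddC mulr0 add0r addrK normrM (gtr0_norm x0).
have -> : e = (`|p.[0]| + 1) * (e / (`|p.[0]| + 1)).
  by rewrite mulrC divfK // gt_eqF.
apply: ltr_pM; rewrite ?normr_ge0 ?(ltW x0) //.
have := dP x; rewrite x0 xd => /(_ isT) h.
have -> : p.[x] = p.[0] + (p.[x] - p.[0]) by rewrite addrC subrK.
by apply: le_lt_trans (ler_normD _ _) _; rewrite ltrD2l.
Qed.

Lemma horner_pos_near0 {R : realFieldType} (s : seq {poly R}) :
  (forall q, q \in s -> 0 < q.[0]) ->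
  exists2 d : R, 0 < d & forall q x, q \in s -> 0 < x < d -> 0 < q.[x].
Proof.
elim: s => [|p s IH] sP; first by exists 1.
have [|d1 d10 d1P] := IH; first by move=> q qs; apply: sP; rewrite inE qs orbT.
have p0 : 0 < p.[0] by apply: sP; rewrite mem_head.
have [d2 d20 d2P] := horner_continuous0 p _ p0.
exists (Num.min d1 d2); first by rewrite lt_min d10.
move=> q x; rewrite inE lt_min => + /and3P[x0 x1 x2].
case/orP => [/eqP->|qs]; last by apply: d1P => //; rewrite x0.
by have := d2P x; rewrite x0 x2 => /(_ isT); rewrite ltr_norml => /andP[+ _]; lra.
Qed.

(** Write p = q X^m with q(0) nonzero. Then q^2 is positive at 0 and joins the list [s], and any
    small positive x works. *)
Lemma exists_generic_near0 {R : realFieldType} (p : {poly R}) (s : seq {poly R}) :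
  p != 0 -> (forall q, q \in s -> 0 < q.[0]) ->
  exists x, p.[x] != 0 /\ forall q, q \in s -> 0 < q.[x].
Proof.
move=> p0 sP.
have [m [q]] := multiplicity_XsubC p 0.
rewrite p0 /= => q0 pE.
have [|d d0 dP] := @horner_pos_near0 R (q ^+ 2 :: s).
  move=> t; rewrite inE => /orP[/eqP->|]; last exact: sP.
  by rewrite horner_exp exprn_even_gt0.
have dd : 0 < d / 2 < d by apply/andP; split; lra.
exists (d / 2); split; last by move=> t ts; apply: dP; rewrite // inE ts orbT.
rewrite pE hornerM horner_exp hornerXsubC subr0.
have := dP (q ^+ 2) (d / 2); rewrite mem_head dd => /(_ isT isT).
rewrite horner_exp exprn_even_gt0 //= => qn0.
by rewrite mulf_neq0 // expf_neq0 // gt_eqF //; case/andP: dd.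
Qed.

(** * Affine forms, hyperplanes and simplices *)

Section Hyper.
Context {R : realType} {d : nat}.
Implicit Types (a x : 'rV[R]_d) (h phi : 'rV[R]_(1 + d)).

(* A row vector of length 1 + d is the affine form with that constant term
   (first entry) and that linear part. *)
Definition aff h x : R := (h *m col_mx 1 x^T) 0 0.

Definition hyper h : set 'rV[R]_d := [set x | aff h x = 0].

Lemma affE h x : aff h x = h 0 0 + dot (rsubmx h) x.
Proof.
rewrite /aff -{1}[h]hsubmxK mul_row_col mulmx1 mxE; congr (_ + _).
  by rewrite mxE; congr (h _ _); apply/val_inj.
by rewrite mxE; apply: eq_bigr => i _; rewrite !mxE.
Qed.

Lemma aff_row m (M : 'M[R]_(m, 1 + d)) i x :
  aff (row i M) x = (M *m col_mx 1 x^T) i 0.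
Proof. by rewrite /aff -row_mul mxE. Qed.

Lemma affZ c h x : aff (c *: h) x = c * aff h x.
Proof. by rewrite /aff -scalemxAl mxE. Qed.

Lemma dotDr a x y : dot a (x + y) = dot a x + dot a y.
Proof. by rewrite /dot -big_split; apply: eq_bigr => i _; rewrite mxE mulrDr. Qed.

Lemma dotZr a c x : dot a (c *: x) = c * dot a x.
Proof. by rewrite /dot mulr_sumr; apply: eq_bigr => i _; rewrite mxE mulrCA. Qed.

Lemma dotC a x : dot a x = dot x a.
Proof. by apply: eq_bigr => i _; rewrite mulrC. Qed.

Lemma dotxx_eq0 x : (dot x x == 0) = (x == 0).
Proof.
apply/eqP/eqP => [h|->]; last first.
  by rewrite /dot big1 // => i _; rewrite mxE mul0r.
apply/rowP => i; rewrite mxE; apply/eqP.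
have /psumr_eq0P : forall i, true -> 0 <= x 0 i * x 0 i.
  by move=> j _; rewrite -expr2 sqr_ge0.
by move=> /(_ h i isT) /eqP; rewrite mulf_eq0 orbb.
Qed.

Lemma affD h x y : aff h (x + y) = aff h x + dot (rsubmx h) y.
Proof. by rewrite !affE dotDr addrA. Qed.

Lemma hyper_normal h : rsubmx h != 0 -> normal_vector (hyper h) (rsubmx h).
Proof.
move=> h0; split => //; exists (- h 0 0).
by apply/seteqP; split => x; rewrite /hyper /= affE => e; lra.
Qed.

Lemma hyper_nonempty h : rsubmx h != 0 -> exists x, hyper h x.
Proof.
rewrite -dotxx_eq0 => h0; exists (- h 0 0 / dot (rsubmx h) (rsubmx h) *: rsubmx h).
by rewrite /hyper /= affE dotZr divfK // subrr.
Qed.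

(** Let y be the component of [a] orthogonal to the normal n of [h]. Moving along y stays in the
    hyperplane, so a.y = 0, and then y.y = 0. *)
Lemma normal_unique h a : rsubmx h != 0 -> normal_vector (hyper h) a ->
  exists2 c : R, c != 0 & a = c *: rsubmx h.
Proof.
move=> n0 [a0 [b hE]]; set n := rsubmx h in n0 *.
have [x0 x0P] := hyper_nonempty h n0.
have nn0 : dot n n != 0 by rewrite dotxx_eq0.
pose y := a + (- (dot n a / dot n n)) *: n.
have ny : dot n y = 0 by rewrite dotDr dotZr mulNr divfK // subrr.
have ay : dot a y = 0.
  have : hyper h (x0 + y) by rewrite /hyper /= affD ny addr0.
  by move: x0P; rewrite hE /= dotDr => -> /(congr1 (fun t => t - b)); rewrite subrr addrC addKr.
have /eqP : dot y y = 0.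
  by rewrite {2}/y dotDr dotZr (dotC y n) ny mulr0 addr0 dotC.
rewrite dotxx_eq0 addr_eq0 scaleNr opprK => /eqP aE.
exists (dot n a / dot n n) => //.
by apply: contraNneq a0 => c0; rewrite aE c0 scale0r.
Qed.

(* phi < 0 on the vertices of the simplex bounded by the rows of M: if the
   coordinates of phi and of the constant form 1 in the basis M are mu and nu,
   then phi takes the value mu_i / nu_i at the i-th vertex. The adjugate makes
   this a polynomial condition on M. *)
Definition negative_on {K : numDomainType} {m} (M : 'M[K]_m.+1) (phi : 'rV[K]_m.+1) :=
  forall i, (phi *m \adj M) 0 i * (delta_mx 0 0 *m \adj M : 'rV_m.+1) 0 i < 0.

Lemma aff_const1 x : aff (delta_mx 0 0) x = 1.
Proof.
rewrite affE mxE /= (_ : rsubmx _ = 0).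
  by rewrite /dot big1 ?addr0 // => i _; rewrite mxE mul0r.
by apply/rowP => i; rewrite !mxE.
Qed.

(** At this vertex [M] sends (1, x) to c e_i. Applying the adjugate gives det(M) f(x) = (f adj M)_i
    c for every form f; the cases f = 1 and f = phi together give det(M)^2 phi(x) = mu_i nu_i
    c^2. *)
Lemma negative_on_vertex (M : 'M[R]_(1 + d)) phi i x :
  \det M != 0 -> negative_on M phi ->
  (forall k, k != i -> aff (row k M) x = 0) -> aff phi x < 0.
Proof.
move=> M0 neg xP.
pose c := aff (row i M) x.
have MxE : M *m col_mx 1 x^T = c *: delta_mx i 0.
  apply/colP => k; rewrite -aff_row !mxE eqxx andbT.
  by have [->|/xP ->] := eqVneq k i; rewrite ?mulr1 ?mulr0.
have E (f : 'rV[R]_(1 + d)) : \det M * aff f x = (f *m \adj M) 0 i * c.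
  have -> : \det M * aff f x = ((f *m \adj M) *m (M *m col_mx 1 x^T)) 0 0.
    by rewrite -mulmxA (mulmxA (\adj M)) mul_adj_mx mul_scalar_mx -scalemxAr mxE.
  by rewrite MxE -scalemxAr mxE mulrC -colE mxE.
have := E (delta_mx 0 0); rewrite aff_const1 mulr1 => E0.
have c0 : c != 0 by apply: contraNneq M0 => c0; rewrite E0 c0 mulr0.
have := neg i; set mu := (X in X * _); set nu := (X in _ * X) => munu.
have : \det M ^+ 2 * aff phi x < 0.
  rewrite expr2 -mulrA E {1}E0 -/mu -/nu (_ : nu * c * _ = mu * nu * c ^+ 2).
    by rewrite nmulr_rlt0 // exprn_even_gt0.
  by ring.
by rewrite pmulr_rlt0 // exprn_even_gt0.
Qed.

Lemma hull_negative (S : set 'rV[R]_d) phi :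
  (forall x, S x -> aff phi x < 0) ->
  forall x, convex_hull S x -> aff phi x < 0.
Proof.
move=> SP x; move: x; apply: smallest_sub => //.
apply/convex_setW => x y; rewrite !inE /= => xn yn k k0 k1; rewrite inE /=.
have -> : aff phi (k%:num *: x + (1 - k%:num) *: y) =
    k%:num * aff phi x + (1 - k%:num) * aff phi y.
  by rewrite !affE dotDr !dotZr; ring.
have : 0 < 1 - k%:num by rewrite subr_gt0.
by move=> k1'; rewrite (lt_le_trans _ (lexx 0)) // -(addr0 0) ltrD // pmulr_rlt0.
Qed.
End Hyper.

(** * Explicit planar configurations and their lift *)

Definition negative_coords {K : numDomainType} {m} (M : 'M[K]_m.+1) (phi : 'rV[K]_m.+1) :=
  exists mu nu : 'rV[K]_m.+1,
    [/\ mu *m M = phi, nu *m M = delta_mx 0 0 & forall i, mu 0 i * nu 0 i < 0].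

(** The adjugate coordinates are det(M) times mu and nu, so the products differ by a positive
    square. Explicit configurations can thus be checked without computing an adjugate. *)
Lemma negative_coords_on {K : realDomainType} {m} (M : 'M[K]_m.+1) (phi : 'rV[K]_m.+1) :
  \det M != 0 -> negative_coords M phi -> negative_on M phi.
Proof.
move=> M0 [mu [nu [muE nuE munu]]] i.
rewrite -muE -nuE -!mulmxA mul_mx_adj !mul_mx_scalar !mxE.
rewrite mulrACA -expr2 pmulr_rlt0 ?munu //.
by rewrite exprn_even_gt0.
Qed.

(* The columns are the coefficients of 1, x and t. *)
Definition plane_lines {K : pzRingType} (a c1 c2 : K) : 'M[K]_3 :=
  \matrix_(i, k) nth 0 (nth [::] [:: [:: 0; 1; a]; [:: c1; 1; 0]; [:: c2; 0; 1]] i) k.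

Definition row3 {K : pzRingType} (x y z : K) : 'rV[K]_3 := \row_k nth 0 [:: x; y; z] k.

Lemma row3_mul_plane_lines {K : pzRingType} (x y z a c1 c2 : K) :
  row3 x y z *m plane_lines a c1 c2 = row3 (y * c1 + z * c2) (x + y) (x * a + z).
Proof.
apply/rowP => k; rewrite !mxE !big_ord_recl big_ord0 !mxE /= addr0.
by case: k => [[|[|[|]]] //= kP]; rewrite !(mulr0, mulr1, add0r, addr0).
Qed.

Lemma row3E {K : pzRingType} (v : 'rV[K]_3) :
  v = row3 (v 0 0) (v 0 1) (v 0 2%:R).
Proof.
by apply/rowP => k; rewrite mxE; case: k => [[|[|[|]]] //= kP]; congr (v _ _); apply/val_inj.
Qed.

Lemma plane_lines_det {K : fieldType} (a c1 c2 : K) :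
  c1 + a * c2 != 0 -> \det (plane_lines a c1 c2) != 0.
Proof.
move=> D0; apply/det0P => -[v v0]; rewrite (row3E v) row3_mul_plane_lines => e.
have := congr1 (fun u : 'rV_3 => u 0 0) e; have := congr1 (fun u : 'rV_3 => u 0 1) e.
have := congr1 (fun u : 'rV_3 => u 0 2%:R) e; rewrite !mxE /=.
set x := v 0 0; set y := v 0 1; set z := v 0 2%:R => e2 e1 e0.
have yE : y = - x by apply/eqP; rewrite -addr_eq0 addrC e1.
have zE : z = - (x * a) by apply/eqP; rewrite -addr_eq0 addrC e2.
have /eqP : x * (c1 + a * c2) = 0.
  by rewrite -[RHS]oppr0 -e0 yE zE; ring.
rewrite mulf_eq0 (negPf D0) orbF => /eqP x0.
move: v0; rewrite (row3E v) -/x -/y -/z yE zE x0 mul0r oppr0 => /eqP; apply.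
by apply/rowP => k; rewrite !mxE; case: k => [[|[|[|]]] //= kP].
Qed.

(** [D] is minus the determinant of the three lines, and [- N] the value of the form where the last
    two lines meet. The three inequalities are the signs of the form at the three vertices, with
    denominators cleared. *)
Lemma plane_lines_negative {K : realFieldType} (a c1 c2 f0 f1 f2 : K)
    (D := c1 + a * c2) (N := c1 * f1 + c2 * f2 - f0) :
  D != 0 -> 0 < N -> f1 * D < N -> a * (f2 * D - a * N) < 0 ->
  negative_coords (plane_lines a c1 c2) (row3 f0 f1 f2).
Proof.
move=> D0 N0 N1 N2.
have D2 : 0 < (D ^+ 2)^-1 by rewrite invr_gt0 exprn_even_gt0.
exists (row3 (N / D) (f1 - N / D) (f2 - a * (N / D))), (row3 (- D^-1) D^-1 (a / D)).
split.
- rewrite row3_mul_plane_lines; congr row3; rewrite /N /D.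
  + by field.
  + by field.
  + by field.
- rewrite row3_mul_plane_lines [RHS]row3E !mxE /=; congr row3; rewrite /D.
  + by field.
  + by field.
  + by field.
- clearbody D N => k; rewrite !mxE; case: k => [[|[|[|]]] //= kP].
  + rewrite (_ : _ * _ = - (N * (D ^+ 2)^-1)); last by field.
    by rewrite oppr_lt0 mulr_gt0.
  + rewrite (_ : (_ - _) * _ = (f1 * D - N) * (D ^+ 2)^-1); last by field.
    by rewrite pmulr_llt0 // subr_lt0.
  + rewrite (_ : (_ - _) * _ = (a * (f2 * D - a * N)) * (D ^+ 2)^-1); last by field.
    by rewrite pmulr_llt0.
Qed.

(* Adding the coordinates y_k to the first form and the hyperplanes y_k = 0
   repeats the coordinates of every planar form on the first line, up to sign,
   on each of the new hyperplanes; the signs of mu_i nu_i are unaffected. *)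
Definition lift_lines {K : pzRingType} n (L : 'M[K]_3) : 'M[K]_(3 + n) :=
  block_mx L (\matrix_(i, k) (i == 0)%:R) 0 1%:M.

Lemma lift_lines_det {K : comPzRingType} n (L : 'M[K]_3) :
  \det (lift_lines n L) = \det L.
Proof. by rewrite det_ublock det1 mulr1. Qed.

Lemma lift_lines_negative {K : numDomainType} n (L : 'M[K]_3) phi :
  negative_coords L phi -> negative_coords (lift_lines n L) (row_mx phi 0).
Proof.
pose T : 'M[K]_(3, n) := \matrix_(i, k) (i == 0)%:R.
have TE (v : 'rV[K]_3) k : (v *m T) 0 k = v 0 0.
  by rewrite mxE !big_ord_recl big_ord0 !mxE /= mulr1 !mulr0 !addr0.
have liftM (v : 'rV[K]_3) : row_mx v (- (v *m T)) *m lift_lines n L = row_mx (v *m L) 0.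
  by rewrite mul_row_block mulmx0 addr0 mulmx1 subrr.
move=> [mu [nu [muE nuE munu]]].
exists (row_mx mu (- (mu *m T))), (row_mx nu (- (nu *m T))); split.
- by rewrite liftM muE.
- rewrite liftM nuE; apply/rowP => k; rewrite mxE [RHS]mxE.
  by case: (@splitP 3 n k) => j kj; rewrite ?mxE /= -[k == 0]val_eqE /= kj.
- move=> i; rewrite mxE [X in _ * X]mxE; case: (@splitP 3 n i) => k _; first exact: munu.
  by rewrite mxE [X in _ * X]mxE !TE mulrNN munu.
Qed.

(** [true] selects the exceptional line of a pair: x = -t, x = 2 or t = -3. *)
Definition base_lines {K : pzRingType} (b0 b1 b2 : bool) : 'M[K]_3 :=
  plane_lines (if b0 then 1 else -1) (if b1 then -2%:R else 1) (if b2 then 3%:R else - 3%:R).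

Lemma base_lines_det {K : realFieldType} b0 b1 b2 : \det (base_lines b0 b1 b2 : 'M[K]_3) != 0.
Proof.
apply: plane_lines_det.
by case: b0; case: b1; case: b2; rewrite ?mulN1r ?mul1r ?opprK; apply/eqP => h; lra.
Qed.

(** * Perturbation to general position *)

Lemma det_distinct_nodes {K : fieldType} n (s : 'I_n -> K) :
  injective s -> \det (\matrix_(i, k < n) s i ^+ k) != 0.
Proof.
move=> sinj.
rewrite -det_tr (_ : _^T = Vandermonde n (\row_i s i)); last first.
  by apply/matrixP => i j; rewrite !mxE.
rewrite det_Vandermonde; apply/prodf_neq0 => i _; apply/prodf_neq0 => j ij.
by rewrite !mxE subr_eq0 (inj_eq sinj); apply: contraTneq ij => ->; rewrite ltnn.
Qed.

(** This is the determinant of normal vectors on the moment curve, where the constant column is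
    gone. Pulling s_i out of row i leaves a Vandermonde matrix. *)
Lemma det_distinct_nodes1 {K : fieldType} n (s : 'I_n -> K) :
  injective s -> (forall i, s i != 0) -> \det (\matrix_(i, k < n) s i ^+ k.+1) != 0.
Proof.
move=> sinj s0.
rewrite (_ : \matrix_(_, _) _ = diag_mx (\row_i s i) *m \matrix_(i, k < n) s i ^+ k).
  rewrite det_mulmx mulf_neq0 ?det_distinct_nodes // det_diag.
  by apply/prodf_neq0 => i _; rewrite mxE.
by apply/matrixP => i k; rewrite mul_diag_mx !mxE exprS.
Qed.

Section Perturbation.
Context {R : realFieldType} {d : nat} {T : finType}.
Variables (b : T -> 'rV[R]_(1 + d)) (Phi : seq 'rV[R]_(1 + d)).

(** The nodes start at 1, since a node 0 would give a zero normal vector. *)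
Let node (p : T) : R := (enum_rank p).+1%:R.

Let node_inj : injective node.
Proof. by move=> p q /eqP; rewrite eqr_nat eqSS => /eqP/val_inj/enum_rank_inj. Qed.

Let node_neq0 p : node p != 0.
Proof. by rewrite pnatr_eq0. Qed.

Let perturbed (x : R) (p : T) : 'rV[R]_(1 + d) :=
  \row_k ((1 - x) * b p 0 k + x * node p ^+ k).

(** The parameter of the segment becomes the indeterminate, so that determinants and sign conditions
    are polynomials in it. *)
Let perturbedX (p : T) : 'rV[{poly R}]_(1 + d) :=
  \row_k ((1 - 'X) * (b p 0 k)%:P + 'X * (node p ^+ k)%:P).

Let hornerE' := (hornerMXaddC, hornerD, hornerN, hornerM, hornerX, hornerC).

Let perturbed_mxE x m (f : 'I_m -> T) :
  map_mx (horner_eval x) (\matrix_i perturbedX (f i)) = \matrix_i perturbed x (f i).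
Proof.
by apply/matrixP => i k; rewrite !mxE /horner_eval !hornerE'.
Qed.

Let detX (f : {ffun 'I_(1 + d) -> T}) := \det (\matrix_i perturbedX (f i)).

Let normal_detX (f : {ffun 'I_d -> T}) := \det (\matrix_i rsubmx (perturbedX (f i))).

Let signX (f : {ffun 'I_(1 + d) -> T}) (phi : 'rV[R]_(1 + d)) (i : 'I_(1 + d)) : {poly R} :=
  let M := \matrix_i perturbedX (f i) in
  - ((map_mx polyC phi *m \adj M) 0 i * (delta_mx 0 0 *m \adj M : 'rV_(1 + d)) 0 i).

Let detXE x f : (detX f).[x] = \det (\matrix_i perturbed x (f i)).
Proof. by rewrite -perturbed_mxE det_map_mx. Qed.

Let normal_detXE x f : (normal_detX f).[x] = \det (\matrix_i rsubmx (perturbed x (f i))).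
Proof.
rewrite -[LHS]/(horner_eval x _) -det_map_mx; congr (\det _).
by apply/matrixP => i k; rewrite !mxE /= /horner_eval !hornerE'.
Qed.

Let signXE x f phi i : (signX f phi i).[x] =
  - ((phi *m \adj (\matrix_i perturbed x (f i))) 0 i *
     (delta_mx 0 0 *m \adj (\matrix_i perturbed x (f i)) : 'rV_(1 + d)) 0 i).
Proof.
rewrite /signX hornerN hornerM -perturbed_mxE.
set M := \matrix_i perturbedX (f i).
have E (v : 'rV[{poly R}]_(1 + d)) : ((v *m \adj M) 0 i).[x] =
    (map_mx (horner_eval x) v *m \adj (map_mx (horner_eval x) M)) 0 i.
  by rewrite -map_mx_adj -map_mxM [RHS]mxE.
have Ephi : map_mx (horner_eval x) (map_mx polyC phi) = phi.
  by apply/rowP => k; rewrite !mxE /horner_eval hornerC.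
have Edelta : map_mx (horner_eval x) (delta_mx 0 0 : 'rV_(1 + d)) = delta_mx 0 0.
  by apply/rowP => k; rewrite !mxE /horner_eval hornerMn hornerC.
by rewrite !E Ephi Edelta.
Qed.

Let perturbed0 p : perturbed 0 p = b p.
Proof. by apply/rowP => k; rewrite mxE subr0 mul1r mul0r addr0. Qed.

Let perturbed1 p : perturbed 1 p = \row_k node p ^+ k.
Proof. by apply/rowP => k; rewrite !mxE subrr mul0r mul1r add0r. Qed.

Lemma exists_perturbation : exists h : T -> 'rV[R]_(1 + d),
  [/\ forall f : 'I_(1 + d) -> T, injective f -> \det (\matrix_i h (f i)) != 0,
      forall f : 'I_d -> T, injective f -> \det (\matrix_i rsubmx (h (f i))) != 0
    & forall (f : 'I_(1 + d) -> T) phi, phi \in Phi ->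
        negative_on (\matrix_i b (f i)) phi -> negative_on (\matrix_i h (f i)) phi].
Proof.
pose P := (\prod_(f : {ffun 'I_(1 + d) -> T} | injectiveb f) detX f) *
          \prod_(f : {ffun 'I_d -> T} | injectiveb f) normal_detX f.
(* Only the sign conditions that hold at parameter 0, for the unperturbed family, have to be
   kept. *)
pose S := [seq q <- [seq signX t.1 phi t.2 |
   t <- enum {: {ffun 'I_(1 + d) -> T} * 'I_(1 + d)}, phi <- Phi] | 0 < q.[0]].
(* Parameter 1 is the moment curve, where every determinant is of Vandermonde type. *)
have nz (q : {poly R}) : q.[1] != 0 -> q != 0 by apply: contraNneq => ->; rewrite horner0.
have P0 : P != 0.
  rewrite mulf_neq0 //; apply/prodf_neq0 => f /injectiveP finj; apply: nz.
    rewrite detXE (_ : \matrix_i _ = \matrix_(i, k < 1 + d) node (f i) ^+ k).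
      by apply: det_distinct_nodes => i j /node_inj /finj.
    by apply/matrixP => i k; rewrite mxE perturbed1 !mxE.
  rewrite normal_detXE (_ : \matrix_i _ = \matrix_(i, k < d) node (f i) ^+ k.+1).
    by apply: det_distinct_nodes1 => // i j /node_inj /finj.
  by apply/matrixP => i k; rewrite mxE perturbed1 !mxE.
have [|x [Px Sx]] := exists_generic_near0 P S P0.
  by move=> q; rewrite mem_filter => /andP[].
move: Px; rewrite hornerM mulf_eq0 negb_or !horner_prod => /andP[/prodf_neq0 P1 /prodf_neq0 P2].
exists (perturbed x); split.
- move=> f finj; have := P1 (finfun f); rewrite detXE.
  under eq_mx do rewrite ffunE.
  by apply; apply/injectiveP => i j; rewrite !ffunE => /finj.
- move=> f finj; have := P2 (finfun f); rewrite normal_detXE.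
  under eq_mx do rewrite ffunE.
  by apply; apply/injectiveP => i j; rewrite !ffunE => /finj.
- move=> f phi phiP neg i.
  have E y : \matrix_i perturbed y (finfun f i) = \matrix_i perturbed y (f i).
    by apply/row_matrixP => j; rewrite !rowK ffunE.
  have E0 : \matrix_i perturbed 0 (f i) = \matrix_i b (f i).
    by apply/row_matrixP => j; rewrite !rowK perturbed0.
  have : signX (finfun f) phi i \in S.
    rewrite mem_filter signXE E E0 oppr_gt0 neg.
    by apply/allpairsP; exists ((finfun f, i), phi); rewrite mem_enum.
  by move=> /Sx; rewrite signXE E oppr_gt0.
Qed.
End Perturbation.

(** * Families of hyperplanes in general position *)

Lemma exists_injection_through {T : finType} d (p q : T) :
  p != q -> (d.+2 <= #|T|)%N ->
  exists f : 'I_d.+2 -> T, [/\ injective f, f 0 = p & f 1 = q].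
Proof.
move=> pq dT.
pose s := p :: q :: rem q (rem p (enum T)).
have s_perm : perm_eq s (enum T).
  rewrite perm_sym (perm_trans (perm_to_rem (mem_enum T p))) // perm_cons.
  by apply: perm_to_rem; rewrite (mem_rem_uniq _ (enum_uniq T)) !inE eq_sym pq mem_enum.
exists (fun i => nth p s i); split => // i j /eqP.
have lt (k : 'I_d.+2) : (k < size s)%N.
  by rewrite (perm_size s_perm) -cardT (leq_trans (ltn_ord k)).
by rewrite nth_uniq // ?(perm_uniq s_perm) ?enum_uniq // => /eqP/val_inj.
Qed.

Lemma fin_cardT {T : finType} : [set: T] #= `I_#|T|.
Proof.
have -> : `I_#|T| = (fun x : T => nat_of_ord (enum_rank x)) @` [set: T].
  apply/seteqP; split => [k /= kT|_ [x _ <-] /=]; last exact: ltn_ord.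
  by exists (enum_val (Ordinal kT)) => //; rewrite enum_valK.
by rewrite card_eq_sym; apply: inj_card_eq => x y _ _ /val_inj/enum_rank_inj.
Qed.

Section GeneralPosition.
Context {R : realType} {d : nat} {T : finType}.
Variable h : T -> 'rV[R]_(1 + d).
Hypothesis d_gt1 : (1 < d)%N.
Hypothesis d_leT : (d <= #|T|)%N.
Hypothesis det_neq0 : forall f : 'I_(1 + d) -> T,
  injective f -> \det (\matrix_i h (f i)) != 0.
Hypothesis normal_det_neq0 : forall f : 'I_d -> T,
  injective f -> \det (\matrix_i rsubmx (h (f i))) != 0.

(** Extend p and q to d distinct indices: proportional normals would make the determinant of these d
    normals vanish. *)
Lemma normals_independent p q c : p != q -> rsubmx (h q) != c *: rsubmx (h p).
Proof using d_gt1 d_leT normal_det_neq0.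
case: d d_gt1 h d_leT normal_det_neq0 => [|[|n]] // _ k nT kdet pq.
have [f [finj f0 f1]] := exists_injection_through n p q pq nT.
apply: contraNneq (kdet f finj) => e.
apply/det0P; exists (delta_mx 0 1 - c *: delta_mx 0 0).
  by apply/eqP => /(congr1 (fun u : 'rV_n.+2 => u 0 1)) /eqP; rewrite !mxE /= mulr0 subr0 oner_eq0.
by rewrite mulmxBl -scalemxAl -!rowE !rowK f0 f1 e subrr.
Qed.

Lemma normal_neq0 p : rsubmx (h p) != 0.
Proof using d_gt1 d_leT normal_det_neq0.
have [q pq] : exists q, q != p.
  apply: contrapT => /forallNP hn.
  have : (#|T| <= #|pred1 p|)%N.
    by apply: subset_leq_card; apply/fintype.subsetP => q _; rewrite inE; apply/negPn/negP/hn.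
  by rewrite card1 leqNgt (leq_trans d_gt1).
by have := normals_independent _ _ 0 pq; rewrite scale0r.
Qed.

Lemma hyper_family_inj : injective (hyper \o h).
Proof using d_gt1 d_leT normal_det_neq0.
move=> p q /= e; apply: contrapT => /eqP pq.
have := hyper_normal _ (normal_neq0 q); rewrite -e.
move=> /(normal_unique _ _ (normal_neq0 p)) [c _] /eqP; apply/negP.
exact: normals_independent.
Qed.

Lemma hyper_family_general_position : general_position (range (hyper \o h)).
Proof using d_gt1 d_leT normal_det_neq0 det_neq0.
split.
- move=> H a Hinj HF Ha.
  have /choice[f fP] : forall i, exists p, hyper (h p) = H i.
    by move=> i; have [p _ pE] := HF i; exists p.
  have finj : injective f by move=> i j fij; apply: Hinj; rewrite -!fP fij.
  (* Any normal vector is a nonzero multiple of the chosen one, so only an invertible diagonal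
     factor enters the determinant. *)
  have /choice[c cP] : forall i, exists c : R, c != 0 /\ a i = c *: rsubmx (h (f i)).
    move=> i; have := Ha i; rewrite -fP => /(normal_unique _ _ (normal_neq0 _))[c c0 cE].
    by exists c.
  rewrite row_free_unit unitmxE unitfE.
  rewrite (_ : \matrix_i a i = diag_mx (\row_i c i) *m \matrix_i rsubmx (h (f i))).
    rewrite det_mulmx mulf_neq0 ?normal_det_neq0 // det_diag.
    by apply/prodf_neq0 => i _; rewrite mxE; have [] := cP i.
  apply/row_matrixP => i; rewrite rowK row_mul row_diag_mx -scalemxAl -rowE rowK.
  by rewrite mxE; have [] := cP i.
- move=> H Hinj HF; apply/seteqP; split => // x xH.
  have /choice[f fP] : forall i, exists p, hyper (h p) = H i.
    by move=> i; have [p _ pE] := HF i; exists p.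
  have finj : injective f by move=> i j fij; apply: Hinj; rewrite -!fP fij.
  have Munit : (\matrix_i h (f i) : 'M_(1 + d)) \in unitmx.
    by rewrite unitmxE unitfE det_neq0.
  have Mx : (\matrix_i h (f i) : 'M_(1 + d)) *m col_mx 1 x^T = 0.
    apply/colP => i; rewrite -aff_row rowK mxE.
    by have := xH i I; rewrite -fP.
  (* A common point x puts (1, x) in the kernel of an invertible matrix, although its first entry is
     1. *)
  have := mulKmx Munit (col_mx 1 x^T); rewrite Mx mulmx0.
  move=> /(congr1 (fun u : 'cV_(1 + d) => u (lshift d 0) 0)) /eqP.
  by rewrite col_mxEu !mxE eq_sym oner_eq0.
Qed.

Lemma simplex_negative (f : 'I_(1 + d) -> T) phi : injective f ->
  negative_on (\matrix_i h (f i)) phi ->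
  forall x, induced_simplex (range (hyper \o h \o f)) x -> aff phi x < 0.
Proof using d_gt1 d_leT normal_det_neq0 det_neq0.
move=> finj neg y; apply: hull_negative => x [_ [i _ <-] xH].
apply: (negative_on_vertex _ _ i _ (det_neq0 f finj) neg).
move=> k ki; rewrite rowK; apply: (xH (hyper (h (f k)))); split; first by exists k.
by move=> /= /hyper_family_inj /finj /eqP; apply/negP.
Qed.

Lemma simplices_disjoint (f g : 'I_(1 + d) -> T) phi : injective f -> injective g ->
  negative_on (\matrix_i h (f i)) phi -> negative_on (\matrix_i h (g i)) (- phi) ->
  induced_simplex (range (hyper \o h \o f)) `&`
  induced_simplex (range (hyper \o h \o g)) = set0.
Proof using d_gt1 d_leT normal_det_neq0 det_neq0.
move=> finj ginj fneg gneg; apply/seteqP; split => // x [].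
move=> /(simplex_negative _ _ finj fneg) x1 /(simplex_negative _ _ ginj gneg).
by rewrite -scaleN1r affZ; lra.
Qed.
End GeneralPosition.

(** * Separated pairs of triangles *)

(* Lines separating the five pairs of triangles listed in separated_types. *)
Definition separators {K : pzRingType} : seq 'rV[K]_3 :=
  [:: row3 3%:R 0 2%:R; row3 1 1 (-1); row3 (-2%:R) 1 1; row3 1 1 1; row3 0 1 0].

Definition separated (K : realFieldType) (s t : bool * bool * bool) :=
  exists phi : 'rV[K]_3,
    [/\ phi \in separators, negative_coords (base_lines s.1.1 s.1.2 s.2) phi
      & negative_coords (base_lines t.1.1 t.1.2 t.2) (- phi)].

Lemma separated_types (K : realFieldType) :
  [/\ separated K (true, true, true) (false, false, false),
      separated K (true, false, false) (false, true, true),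
      separated K (true, false, true) (false, true, false),
      separated K (false, false, true) (true, true, false)
    & separated K (true, false, false) (false, true, false)].
Proof.
have oppE (x y z : K) : - row3 x y z = row3 (- x) (- y) (- z).
  by apply/rowP => k; rewrite !mxE; case: k => [[|[|[|]]] //= kP].
have mem k : (k < 5)%N -> nth 0 separators k \in @separators K.
  by move=> k5; apply: mem_nth.
split; [exists (nth 0 separators 0)|exists (nth 0 separators 1)
  |exists (nth 0 separators 2)|exists (nth 0 separators 3)|exists (nth 0 separators 4)];
  split; rewrite ?mem //= ?oppE; apply: plane_lines_negative; rewrite /=;
  try (apply/eqP => ?); lra.
Qed.

(** [j0], [j1], [j2] stand for the parts holding the three exceptional lines. If all coincide, any
    other part is complementary; if exactly two do, the part with two exceptional lines and the part
    with one are complementary; otherwise [j0] and [j1] form the fifth separated pair. *)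
Lemma exists_separated_parts (K : realFieldType) (I : finType) (j0 j1 j2 : I) :
  (1 < #|I|)%N ->
  let type j := (j == j0, j == j1, j == j2) in
  exists j j', j != j' /\ separated K (type j) (type j').
Proof.
move=> I_gt1 /=; have [h0 h1 h2 h3 h4] := separated_types K.
have [e01|n01] := eqVneq j0 j1; have [e02|n02] := eqVneq j0 j2.
- have [j jn] : exists j, j != j0.
    apply: contrapT => /forallNP hn.
    have : (#|I| <= #|pred1 j0|)%N.
      by apply: subset_leq_card; apply/fintype.subsetP => q _; apply/negPn/negP/hn.
    by rewrite card1 leqNgt I_gt1.
  by exists j0, j; rewrite eq_sym jn -e01 -e02 eqxx (negPf jn).
- by exists j2, j0; rewrite -e01 !eqxx (negPf n02) eq_sym (negPf n02).
- exists j0, j1; rewrite -e02 !eqxx n01 (negPf n01).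
  by rewrite eq_sym (negPf n01).
- have [e12|n12] := eqVneq j1 j2.
    exists j0, j1; rewrite -e12 !eqxx n01 (negPf n01).
    by rewrite eq_sym (negPf n01).
  exists j0, j1; rewrite !eqxx n01 (negPf n01) (negPf n02) (negPf n12).
  by rewrite eq_sym (negPf n01).
Qed.

(** * The base family and rainbow partitions *)

(* The hyperplane with index j = 0 is the exceptional one in each of the first
   three families. *)
Definition base_hyper {K : pzRingType} r n (p : 'I_(3 + n) * 'I_r) : 'rV[K]_(3 + n) :=
  let b := p.2 == 0%N :> nat in row p.1 (lift_lines n (base_lines b b b)).

(** Each row depends on at most its own boolean, so [base_hyper] may pass the same one three times;
    the choices in the further families do not matter. *)
Lemma base_hyper_mx {K : pzRingType} r n (s : 'I_(3 + n) -> 'I_r)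
    (b := fun i : 'I_3 => s (lshift n i) == 0%N :> nat) :
  \matrix_i base_hyper r n (i, s i) =
  lift_lines n (base_lines (b 0) (b 1) (b 2%:R)) :> 'M[K]_(3 + n).
Proof.
apply/row_matrixP => i; rewrite rowK /base_hyper /=.
rewrite -(fintype.splitK i); case: (fintype.split i) => k /=; last by rewrite !rowKd.
rewrite !rowKu !row_row_mx; congr row_mx; apply/rowP => j; rewrite !mxE /b.
case: k => [[|[|[|]]] //= kP].
- by rewrite (_ : Ordinal kP = 0) //; apply/val_inj.
- by rewrite (_ : Ordinal kP = 1) //; apply/val_inj.
- by rewrite (_ : Ordinal kP = 2%:R) //; apply/val_inj.
Qed.

(** [s j i] is the index of the member of family i in part j; disjointness of the parts makes it
    injective in j. *)
Lemma rainbow_partition {V : Type} {I J : finType} (c : I * J -> V) (A : J -> set V) :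
  injective c ->
  partition [set: J] A (\bigcup_(i in [set: I]) range (fun k => c (i, k))) ->
  (forall j i, exists! v, (A j `&` range (fun k => c (i, k))) v) ->
  exists s : J -> I -> J,
    (forall j, A j = range (fun i => c (i, s j i))) /\
    forall i, injective (s ^~ i).
Proof.
move=> cinj [Acover Atriv _] Auniq.
have /choice[s sP] : forall j, exists f : I -> J, forall i, A j (c (i, f i)).
  move=> j; have /choice[f fP] : forall i, exists k, A j (c (i, k)).
    by move=> i; have [v [[Av [k _ vE]] _]] := Auniq j i; exists k; rewrite vE.
  by exists f.
exists s; split => [j|i j j' sjj'].
- apply/seteqP; split => [v Av|_ [i _ <-]]; last exact: sP.
  have [i _ [k _ vE]] : (\bigcup_(i in [set: I]) range (fun k => c (i, k))) v.
    by rewrite -Acover; exists j.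
  exists i => //; have [w [_ wuniq]] := Auniq j i.
  rewrite -(wuniq (c (i, s j i))); last by split; [exact: sP|exists (s j i)].
  by rewrite (wuniq v) //; split => //; exists k.
- apply: (Atriv j j') => //; exists (c (i, s j i)); split; first exact: sP.
  by rewrite sjj'; exact: sP.
Qed.

Theorem theorem1p4 (R : realType) (r d : nat) (hr : (2 <= r)%N) (hd : (2 <= d)%N) :
  exists X : 'I_d.+1 -> set (set 'rV[R]_d),
    [/\ forall i : 'I_d.+1, X i #= `I_r /\ (forall H, X i H -> hyperplane H),
        \bigcup_(i in [set: 'I_d.+1]) X i #= `I_(r * d.+1)%N,
        general_position (\bigcup_(i in [set: 'I_d.+1]) X i)
      & forall A : 'I_r -> set (set 'rV[R]_d),
          partition [set: 'I_r] A (\bigcup_(i in [set: 'I_d.+1]) X i) ->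
          (forall (j : 'I_r) (i : 'I_d.+1), exists! H, (A j `&` X i) H) ->
          exists j j' : 'I_r,
            j != j' /\
            induced_simplex (A j) `&` induced_simplex (A j') = set0].
Proof.
case: d hd => [|[|n]] // _.
(* Both signs occur, since the two simplices lie on opposite sides of a separator. *)
pose Phi := [seq row_mx phi 0 : 'rV[R]_(3 + n) | phi <- separators ++ map -%R separators].
have [h [hdet hndet hneg]] := @exists_perturbation R n.+2 _ (@base_hyper R r n) Phi.
have dT : (n.+2 <= #|{: 'I_n.+3 * 'I_r}|)%N.
  by rewrite card_prod !card_ord (leq_trans _ (leq_pmulr _ _)) // (leq_trans _ hr).
have hinj := hyper_family_inj h isT dT hndet.
pose c := hyper \o h.
have XE : \bigcup_(i in [set: 'I_n.+3]) range (fun k => c (i, k)) = range c.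
  apply/seteqP; split => [v [i _ [k _ <-]]|v [[i k] _ <-]]; first by exists (i, k).
  by exists i => //; exists k.
exists (fun i => range (fun k => c (i, k))); split.
- move=> i; split.
    rewrite -[X in `I_X](card_ord r); apply: card_eq_trans (fin_cardT (T := 'I_r)).
    by apply: inj_card_eq => k k' _ _ /hinj[].
  move=> H [k _ <-]; exists (rsubmx (h (i, k))).
  exact/hyper_normal/(normal_neq0 h isT dT hndet).
- rewrite XE (_ : (r * _)%N = #|{: 'I_n.+3 * 'I_r}|); last first.
    by rewrite card_prod !card_ord mulnC.
  by apply: card_eq_trans fin_cardT; apply: inj_card_eq => p q _ _ /hinj.
- by rewrite XE; exact: hyper_family_general_position.
- move=> A Apart Auniq.
  have [s [sA sinj]] := rainbow_partition c A hinj Apart Auniq.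
  pose z : 'I_r := Ordinal (ltnW hr).
  (* A self-injection of a finite type is invertible: [part k] is the part holding the exceptional
     hyperplane, the one of index [z], of family k. *)
  pose part (k : 'I_3) := invF (sinj (lshift n k)) z.
  have partE k j : (s j (lshift n k) == 0%N :> nat) = (j == part k).
    rewrite -[RHS](inj_eq (sinj (lshift n k))) /=.
    have /= := f_invF (sinj (lshift n k)) z; rewrite -/(part k) => ->.
    by rewrite -val_eqE.
  have [|j [j' [jj' [phi [phiS jneg j'neg]]]]] :=
    exists_separated_parts R _ (part 0) (part 1) (part 2%:R).
    by rewrite card_ord.
  exists j, j'; split => //; rewrite !sA.
  have pair_inj k : injective (fun i : 'I_n.+3 => (i, s k i)) by move=> i i' [].
  have oppE : - (row_mx phi 0 : 'rV[R]_(1 + n.+2)) = row_mx (- phi) (0 : 'rV_n).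
    by have := opp_row_mx phi (0 : 'rV[R]_n); rewrite oppr0.
  apply: (simplices_disjoint h isT dT hdet hndet
    (fun i => (i, s j i)) (fun i => (i, s j' i)) (row_mx phi 0)) => //.
  + apply: hneg; first by apply/mapP; exists phi; rewrite // mem_cat phiS.
    rewrite base_hyper_mx !partE; apply: negative_coords_on.
      by rewrite lift_lines_det base_lines_det.
    exact: lift_lines_negative.
  + rewrite oppE; apply: hneg.
      by apply/mapP; exists (- phi); rewrite // mem_cat map_f ?orbT.
    rewrite base_hyper_mx !partE; apply: negative_coords_on.
      by rewrite lift_lines_det base_lines_det.
    exact: lift_lines_negative.
Qed.
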